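(* Let $\mathbf{J} = (T,h,\varnothing)$ be an ordinal iterator and let $\tau : \mathsf{Fin} \to T$ be the assignment of finite sets in $\mathbf{J}$. Then: (1) $\tau(A) \approx A$ for all $A \in \mathsf{Fin}$ and therefore $\tau(A) = \tau(A')$ if and only if $A \approx A'$. In particular $\tau(\tau(A)) = \tau(A)$ for all $A \in \mathsf{Fin}$ and $\tau(B) = B$ for all $B \in T$. (2) $\mathbf{J}$ is a Peano iterator. (3) If $A, A' \in \mathsf{Fin}$ with $A \subset A'$ then $\tau(A) \subset \tau(A')$. (4) If $A, A' \in \mathsf{Fin}$ with $A \preceq A'$ then $\tau(A) \subset \tau(A')$. (5) For all $B, B' \in T$ either $B \subset B'$ or $B' \subset B$. Thus $T$ is totally ordered by inclusion. Moreover, inclusion is the unique total order on $T$ compatible with $\mathbf{J}$.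
   Context: A set $E$ is finite if $\mathcal{P}(E)$ is the only subset $\mathcal{S}$ of the power set $\mathcal{P}(E)$ such that $\varnothing \in \mathcal{S}$ and $F \cup \{e\} \in \mathcal{S}$ whenever $F \in \mathcal{S}$, $F \neq E$ and $e \in E \setminus F$ (this is equivalent to the usual notion of finiteness). $\mathsf{Fin}$ denotes the (proper) class of all finite sets. $A \approx B$ means there exists a bijective mapping $A \to B$, and $A \preceq B$ means there exists an injective mapping $A \to B$. An iterator is a triple $\mathbf{I} = (X,f,x_0)$ with $X$ a class (a set or a proper class), $f : X \to X$ a mapping and $x_0$ an element of $X$. The assignment of finite sets in $\mathbf{I}$ is the unique mapping $\omega : \mathsf{Fin} \to X$ with $\omega(\varnothing) = x_0$ and $\omega(A \cup \{a\}) = f(\omega(A))$ for each finite set $A$ and each element $a \notin A$. A subclass $Y$ of $X$ is $f$-invariant if $f(y) \in Y$ for all $y \in Y$. $\mathbf{I}$ is minimal if the only $f$-invariant subclass of $X$ containing $x_0$ is $X$ itself, and it is a Peano iterator if it is minimal, $f$ is injective and $x_0 \notin f(X)$. A total order $\le$ on $X$ is compatible with $\mathbf{I}$ if $x \le f(x)$ for all $x \in X$. An ordinal iterator is a minimal iterator $\mathbf{J} = (T,h,\varnothing)$, with $T$ a subclass of $\mathsf{Fin}$, such that for each $B \in T$ there exists an element $b \notin B$ with $h(B) = B \cup \{b\}$. *)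

(* Defs.v *)
From HB Require Import structures.
From mathcomp Require Import all_boot finmap.
From mathcomp Require Import boolp classical_sets functions cardinality.

Set Implicit Arguments.
Unset Strict Implicit.
Unset Printing Implicit Defensive.

Local Open Scope classical_set_scope.
Local Open Scope card_scope.

(* The universe of discourse is an arbitrary type U: a class of objects is a
   [set U] and the finite sets are those [A : set U] with [finite A].
   The classes of sets in play (Fin, T) then have type [set (set U)]. *)

Definition powerclass {U : Type} (E : set U) : set (set U) :=
  [set F | F `<=` E].

(* Finiteness without reference to the natural numbers; see [finiteE] for the
   agreement with [finite_set]. *)
Definition finite {U : Type} (E : set U) : Prop :=
  forall S : set (set U),
    S `<=` powerclass E ->
    S set0 ->
    (forall F e, S F -> F <> E -> (E `\` F) e -> S (F `|` [set e])) ->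
    S = powerclass E.

Definition Fin (U : Type) : set (set U) := [set A | finite A].
Arguments Fin U : clear implicits.

(* The class X of an iterator is a subclass [carrier] of an ambient type E; the
   values of [step] outside of [carrier] are irrelevant. *)
Record iterator (E : Type) := Iterator {
  carrier : set E;
  step : {fun carrier >-> carrier};
  base : E;
  base_carrier : carrier base
}.

Section Iterators.
Context {E : Type} (I : iterator E).

Definition invariant_class (Y : set E) : Prop :=
  forall y, Y y -> Y (step I y).

Definition minimal_iterator : Prop :=
  forall Y : set E, Y `<=` carrier I ->
    invariant_class Y -> Y (base I) -> Y = carrier I.

Definition peano_iterator : Prop :=
  [/\ minimal_iterator, set_inj (carrier I) (step I) &
      ~ (step I @` carrier I) (base I)].

Definition is_assignment {U : Type} (w : {fun Fin U >-> carrier I}) : Prop :=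
  w set0 = base I /\
  forall (A : set U) (a : U), Fin U A -> ~ A a ->
    w (A `|` [set a]) = step I (w A).

Definition compatible_order (R : E -> E -> Prop) : Prop :=
  forall x, carrier I x -> R x (step I x).

End Iterators.

Definition total_order_on {E : Type} (X : set E) (R : E -> E -> Prop) : Prop :=
  [/\ forall x, X x -> R x x,
      forall x y, X x -> X y -> R x y -> R y x -> x = y,
      forall x y z, X x -> X y -> X z -> R x y -> R y z -> R x z &
      total_on X R].

Definition ordinal_iterator {U : Type} (J : iterator (set U)) : Prop :=
  [/\ minimal_iterator J, base J = set0, carrier J `<=` Fin U &
      forall B, carrier J B ->
        exists2 b, ~ B b & step J B = B `|` [set b]].

Lemma finiteE (U : Type) (A : set U) : finite A <-> finite_set A.
Proof.
split=> [finA|].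
  have /(_ _ _ _)/seteqP[| | |_ /(_ A)[]//] :=
    finA [set F | F `<=` A /\ finite_set F].
  - by move=> F [].
  - by split=> //; exact: sub0set.
  - move=> F e [FA finF] _ [Ae _]; split; first by move=> x [/FA|->].
    by rewrite finite_setU; split=> //; exact: finite_set1.
move=> finA S SA S0 Sadd; apply/seteqP; split=> // F FA.
have /(@finite_fsetP {classic U})[X FX] : finite_set F by exact: sub_finite_set finA.
move: F FX FA; elim/finSet_rect: X => X IH F -> XA.
case: (fset_0Vmem X) => [->|[x xX]]; first by rewrite set_fset0.
have XE : [set` X] = [set` (X `\ x)%fset] `|` [set x].
  apply/seteqP; split=> y /=; rewrite !inE.
    by move=> yX; case: (eqVneq y x) => [->|yx]; [right|left].
  by case=> [/andP[]|->].
have nx : ~ [set` (X `\ x)%fset] x by rewrite /= !inE eqxx.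
have Ax : A x by exact: XA.
rewrite XE; apply: Sadd; [|by move=> h; apply: nx; rewrite h|by split].
apply: (IH (X `\ x)%fset) => //; first by rewrite fproperD1.
by move=> y /=; rewrite !inE => /andP[_ /XA].
Qed.

Lemma assignment_exists (E : Type) (I : iterator E) (U : Type) :
  exists w : {fun Fin U >-> carrier I}, is_assignment w.
Proof.
pose g (A : set {classic U}) := iter #|` fset_set A| (step I) (base I).
have gI : set_fun (Fin U) (carrier I) g.
  move=> A _; rewrite /g; elim: #|` _| => [|n IHn] /=; first exact: base_carrier.
  exact: funS.
pose gm := isFun.Build _ _ (Fin U) (carrier I) g gI.
pose w : {fun Fin U >-> carrier I} := HB.pack g gm.
exists w; split=> [|A a]; first by rewrite /= /g fset_set0 cardfs0.
move=> /finiteE finA nAa.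
rewrite /= /g setUC (@fset_setU1 {classic U}) // cardfsU1.
by rewrite (@in_fset_set {classic U}) // memNset.
Qed.

Lemma assignment_unique (E : Type) (I : iterator E) (U : Type)
    (w w' : {fun Fin U >-> carrier I}) :
  is_assignment w -> is_assignment w' -> forall A, Fin U A -> w A = w' A.
Proof.
move=> [w0 wS] [w'0 w'S] A finA.
pose S := [set F | [/\ F `<=` A, Fin U F & w F = w' F]].
suff /seteqP[_ /(_ A)[]//] : S = powerclass A by [].
apply: finA; first by move=> F [].
  by split; [exact: sub0set|exact/finiteE|rewrite w0 w'0].
move=> F e [FA finF wF] _ [Ae nFe]; split; first by move=> x [/FA|->].
  by apply/finiteE; rewrite finite_setU; split; [exact/finiteE|exact: finite_set1].
by rewrite wS // w'S // wF.
Qed.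

(* Main.v *)
Require Import Defs.
From mathcomp Require Import all_boot.
From mathcomp Require Import boolp classical_sets functions cardinality.

Local Open Scope classical_set_scope.
Local Open Scope card_scope.

(** Minimality says that the carrier of an iterator is the orbit
    [x0, f x0, f (f x0), ...] of its base point, so everything can be read off
    from the index [n] of the [n]-th iterate ([carrier_iterateP]).  In an ordinal
    iterator each step adds one new element; hence the [n]-th iterate has exactly
    [n] elements ([card_iterate]) and the iterates increase with [n]
    ([iterate_subset]).  On the other side, the assignment of finite sets makes
    one step per element, so it sends every [n]-element set to the [n]-th iterate
    ([assignment_iterate]).  Thus the elements of [T] are the canonical
    representatives of the finite cardinals: [tau] computes the cardinal, and
    comparing sets by injections, comparing indices and comparing iterates by
    inclusion all amount to the same thing.

    Two iterates with different indices have different cardinals, which gives the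
    Peano properties.  For the last claim, any compatible order [R] satisfies
    [R (iterate m) (iterate n)] when [m <= n], by transitivity along the steps
    ([compatible_order_iterate]); since inclusion is total on [T], antisymmetry
    of [R] then leaves no room for [R] to differ from inclusion. *)

(** * Iterates of the base point *)

Definition iterate {E : Type} (I : iterator E) (n : nat) : E :=
  iter n (step I) (base I).

Lemma iterate_carrier {E : Type} (I : iterator E) n : carrier I (iterate I n).
Proof.
elim: n => [|n IHn]; first exact: base_carrier.
by rewrite /iterate iterS; apply: funS.
Qed.

(** The iterates form an invariant class containing the base point, so in a
    minimal iterator they exhaust the carrier. *)
Lemma carrier_iterateP {E : Type} (I : iterator E) : minimal_iterator I ->
  forall x, carrier I x -> exists n, x = iterate I n.
Proof.
move=> minI x.
rewrite -(minI [set y | exists n, y = iterate I n]) //.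
- by move=> _ [n ->]; apply: iterate_carrier.
- by move=> _ [n ->]; exists n.+1.
- by exists 0.
Qed.

(** An assignment makes one step of the iterator per element, starting from the
    empty set; peeling off the elements of [A] one by one shows that it depends
    only on their number. *)
Lemma assignment_iterate {E U : Type} {I : iterator E}
    {w : {fun Fin U >-> carrier I}} : is_assignment w ->
  forall n (A : set U), A #= `I_n -> w A = iterate I n.
Proof.
move=> [w0 wS]; elim=> [|n IHn] A cardA.
  by move: cardA; rewrite II0 card_eq0 => /eqP ->.
have /eq_cardSP[a Aa cardAa] := cardA.
rewrite -(setD1K Aa) setUC wS ?IHn //.
- by apply/finiteE; exists n.
- by case=> _; apply.
Qed.

(** Compatibility compares consecutive elements only; transitivity propagates
    it along the orbit. *)
Lemma compatible_order_iterate {E : Type} {I : iterator E}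
    {R : E -> E -> Prop} :
  total_order_on (carrier I) R -> compatible_order I R ->
  forall m n, (m <= n)%N -> R (iterate I m) (iterate I n).
Proof.
move=> [Rxx _ Rtrans _] Rstep m n /subnK <-.
elim: (n - m)%N => [|k IHk]; first exact/Rxx/iterate_carrier.
apply: (Rtrans _ (iterate I (k + m))) => //; try exact: iterate_carrier.
exact/Rstep/iterate_carrier.
Qed.

(** * Iterates of an ordinal iterator *)

Section OrdinalIterator.
Context {U : Type} {J : iterator (set U)} (hJ : ordinal_iterator J).

Lemma step_subset : compatible_order J subset.
Proof.
case: hJ => _ _ _ stepJ B /stepJ[b _ ->].
exact: subsetUl.
Qed.

Lemma card_iterate n : iterate J n #= `I_n.
Proof.
case: hJ => _ base0 _ stepJ.
elim: n => [|n IHn]; first by rewrite /iterate /= base0 II0.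
have [b nBb stepB] := stepJ _ (iterate_carrier J n).
apply/eq_cardSP; exists b; rewrite /iterate iterS stepB; first by right.
by rewrite setUDK // => _ [->].
Qed.

Lemma iterate_card_eq m n : iterate J m #= iterate J n -> m = n.
Proof.
by rewrite (card_eql (card_iterate m)) (card_eqr (card_iterate n)) => /card_eq_II.
Qed.

Lemma iterate_inj : injective (iterate J).
Proof. by move=> m n eq_mn; apply: iterate_card_eq; rewrite eq_mn. Qed.

Lemma iterate_subset m n : (m <= n)%N -> iterate J m `<=` iterate J n.
Proof.
move=> /subnK <-; elim: (n - m)%N => [//|k IHk].
exact/(subset_trans IHk)/step_subset/iterate_carrier.
Qed.

(** Under the indexing of the carrier by cardinals, the base point is zero and
    the step is the successor. *)
Lemma ordinal_iterator_peano : peano_iterator J.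
Proof.
have [minJ _ _ _] := hJ; split=> //.
- move=> x y; rewrite !inE => /(carrier_iterateP _ minJ)[m ->].
  move=> /(carrier_iterateP _ minJ)[n ->] eqS.
  by have [->] := iterate_inj m.+1 n.+1 eqS.
- move=> [x /(carrier_iterateP _ minJ)[n ->] eq0].
  by have := iterate_inj n.+1 0 eq0.
Qed.

Lemma carrier_subset_total : total_on (carrier J) subset.
Proof.
have [minJ _ _ _] := hJ.
move=> _ _ /(carrier_iterateP _ minJ)[m ->] /(carrier_iterateP _ minJ)[n ->].
by case/orP: (leq_total m n) => le; [left|right]; apply: iterate_subset.
Qed.

Lemma carrier_subset_order : total_order_on (carrier J) subset.
Proof.
split=> [B _|B B' _ _ sBB' sB'B|B C D _ _ _|]; first exact: subset_refl.
- exact/seteqP.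
- exact: subset_trans.
- exact: carrier_subset_total.
Qed.

(** Both relations hold along increasing indices; if one of them holds between
    [iterate J m] and [iterate J n] with [n <= m], antisymmetry forces these
    iterates to be equal. *)
Lemma compatible_order_unique {R R' : set U -> set U -> Prop} :
  total_order_on (carrier J) R -> compatible_order J R ->
  total_order_on (carrier J) R' -> compatible_order J R' ->
  forall B B', carrier J B -> carrier J B' -> R B B' -> R' B B'.
Proof.
move=> ordR compR ordR' compR' B B'.
have [minJ _ _ _] := hJ; have [_ Ranti _ _] := ordR; have [R'xx _ _ _] := ordR'.
move=> /(carrier_iterateP _ minJ)[m ->] /(carrier_iterateP _ minJ)[n ->] Rmn.
have [le_mn|/ltnW le_nm] := leqP m n.
  exact: compatible_order_iterate ordR' compR' _ _ le_mn.
rewrite (Ranti (iterate J m) (iterate J n)) //; try exact: iterate_carrier.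
  exact/R'xx/iterate_carrier.
exact: compatible_order_iterate ordR compR _ _ le_nm.
Qed.

(** * The assignment of finite sets computes cardinals *)

Context {tau : {fun Fin U >-> carrier J}} (htau : is_assignment tau).

Lemma assignment_card_eq A : Fin U A -> tau A #= A.
Proof.
move=> /finiteE[n cardA]; rewrite (assignment_iterate htau _ _ cardA).
by rewrite (card_eqr cardA) card_iterate.
Qed.

Lemma assignment_eqP A A' : Fin U A -> Fin U A' ->
  tau A = tau A' <-> A #= A'.
Proof.
move=> finA finA'; split=> [eq_tau|eqAA'].
  rewrite -(card_eql (assignment_card_eq _ finA)) eq_tau.
  exact: assignment_card_eq.
have /finiteE[n cardA'] := finA'.
rewrite (assignment_iterate htau _ _ cardA') (assignment_iterate htau n) //.
by rewrite (card_eql eqAA').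
Qed.

Lemma assignment_id B : carrier J B -> tau B = B.
Proof.
have [minJ _ _ _] := hJ; move=> /(carrier_iterateP _ minJ)[n ->].
exact/(assignment_iterate htau)/card_iterate.
Qed.

Lemma assignment_card_le A A' : Fin U A -> Fin U A' ->
  A #<= A' -> tau A `<=` tau A'.
Proof.
move=> /finiteE[m cardA] /finiteE[n cardA'].
rewrite (card_le_eql cardA) (card_le_eqr cardA') card_le_II => le_mn.
rewrite (assignment_iterate htau _ _ cardA) (assignment_iterate htau _ _ cardA').
exact: iterate_subset.
Qed.

End OrdinalIterator.

Theorem theorem8p3 (U : Type) (J : iterator (set U))
    (tau : {fun Fin U >-> carrier J})
    (hJ : ordinal_iterator J) (htau : is_assignment tau) :
  ((forall A, Fin U A -> tau A #= A) /\
   (forall A A', Fin U A -> Fin U A' -> (tau A = tau A' <-> A #= A')) /\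
   (forall A, Fin U A -> tau (tau A) = tau A) /\
   (forall B, carrier J B -> tau B = B)) /\
  peano_iterator J /\
  (forall A A', Fin U A -> Fin U A' -> A `<=` A' -> tau A `<=` tau A') /\
  (forall A A', Fin U A -> Fin U A' -> A #<= A' -> tau A `<=` tau A') /\
  ((forall B B', carrier J B -> carrier J B' -> B `<=` B' \/ B' `<=` B) /\
   total_order_on (carrier J) subset /\
   compatible_order J subset /\
   (forall R : set U -> set U -> Prop,
      total_order_on (carrier J) R -> compatible_order J R ->
      forall B B', carrier J B -> carrier J B' -> (R B B' <-> B `<=` B'))).
Proof.
have ordS := carrier_subset_order hJ; have compS := step_subset hJ.
split; [split; [|split; [|split]]|split; [|split; [|split; [|split; [|split; [|split]]]]]].
- exact: (assignment_card_eq hJ htau).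
- exact: (assignment_eqP hJ htau).
- by move=> A finA; apply/(assignment_id hJ htau)/funS.
- exact: (assignment_id hJ htau).
- exact: ordinal_iterator_peano.
- move=> A A' finA finA' sAA'.
  exact/(assignment_card_le hJ htau)/subset_card_le.
- exact: (assignment_card_le hJ htau).
- exact: carrier_subset_total.
- exact: ordS.
- exact: compS.
- move=> R ordR compR B B' TB TB'; split.
    exact: (compatible_order_unique hJ ordR compR ordS compS).
  exact: (compatible_order_unique hJ ordS compS ordR compR).
Qed.
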